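(* Let $N\ge 1$, $K\in\{0,\ldots,N\}$, $\mathcal N=\{1,\ldots,N\}$, and fix a slot $t$. For each $n\in\mathcal N$ let $s_n(t)\in\mathbb R$ be the learned reliability score of device $n$ and let $\mathcal V_n^\star(t)\in\mathbb R$ be a reference reliability value for device $n$. Write $s(t)=(s_1(t),\ldots,s_N(t))$, $\mathcal V^\star(t)=(\mathcal V_1^\star(t),\ldots,\mathcal V_N^\star(t))$, and let $$S_t^\star=\operatorname{TopK}_{+}(\mathcal V^\star(t)),\qquad \widehat S_t=\operatorname{TopK}_{+}(s(t)).$$ Define the selection loss $$\mathcal L_t^{\mathrm{sel},\star}=\sum_{n\in S_t^\star}\mathcal V_n^\star(t)-\sum_{n\in\widehat S_t}\mathcal V_n^\star(t).$$ Suppose that real numbers $\varepsilon_1(t),\ldots,\varepsilon_N(t)$ satisfy $$|s_n(t)-\mathcal V_n^\star(t)|\le\varepsilon_n(t),\qquad n=1,\ldots,N.$$ Then $$0\le\mathcal L_t^{\mathrm{sel},\star}\le\sum_{n\in S_t^\star}\varepsilon_n(t)+\sum_{n\in\widehat S_t}\varepsilon_n(t)\le 2K\,\varepsilon_{\max}(t),$$ where $\varepsilon_{\max}(t)=\max_{n\in\mathcal N}\varepsilon_n(t)$.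
   Context: A base station may pull at most $K$ of $N$ devices in each slot. Learned reliability scores: $s_n(t)=\widehat{\mathcal J}_n^0(t+1)-\widehat{\mathcal J}_n^1(t+1)$, the difference between the predicted reliability costs of device $n$ under the skip action ($a=0$) and the pull action ($a=1$), where $$\widehat{\mathcal J}_n^a(t+1)=\omega_n\Big[\alpha\,\frac{\widehat I_n^a(t+1)}{s_I}+(1-\alpha)\,\frac{\widehat e_n^a(t+1)}{s_e}\Big],$$ with $\omega_n>0$, $\alpha\in[0,1]$, $s_I>0$, $s_e>0$ fixed constants and $\widehat I_n^a(t+1)\ge 0$, $\widehat e_n^a(t+1)\ge 0$ given real numbers (predictions of next-slot ensemble disagreement and estimation error, with negative predictions replaced by zero). The reference values $\mathcal V_n^\star(t)$ are arbitrary real numbers. $\operatorname{TopK}_{+}$: for a vector $x=(x_1,\ldots,x_N)\in\mathbb R^N$, $\operatorname{TopK}_{+}(x)$ is the set of indices of the largest strictly positive entries of $x$, up to the budget $K$. Equivalently, it is a set $$\operatorname{TopK}_{+}(x)\in\arg\max_{S\subseteq\mathcal N,\ |S|\le K}\ \sum_{n\in S}x_n$$ with the convention that indices $n$ with $x_n\le 0$ are not selected (ties are broken arbitrarily). *)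

(* Defs.v *)
From HB Require Import structures.
From mathcomp Require Import all_boot all_order all_algebra.

Set Implicit Arguments.
Unset Strict Implicit.
Unset Printing Implicit Defensive.

Import Order.TTheory GRing.Theory Num.Theory.
Local Open Scope ring_scope.

(* An action is a boolean: [false] is skip (a = 0), [true] is pull (a = 1). *)
Definition predicted_cost (R : realFieldType) (N : nat)
    (omega : 'I_N -> R) (alpha sI se : R) (Ihat ehat : bool -> nat -> 'I_N -> R)
    (a : bool) (t : nat) (n : 'I_N) : R :=
  omega n * (alpha * (Ihat a t n / sI) + (1 - alpha) * (ehat a t n / se)).

Definition score (R : realFieldType) (N : nat)
    (omega : 'I_N -> R) (alpha sI se : R) (Ihat ehat : bool -> nat -> 'I_N -> R)
    (t : nat) (n : 'I_N) : R :=
  predicted_cost omega alpha sI se Ihat ehat false t.+1 n -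
  predicted_cost omega alpha sI se Ihat ehat true t.+1 n.

Definition positive_entries (R : realFieldType) (N : nat) (x : 'I_N -> R) :
  {set 'I_N} := [set n | 0 < x n].

(* Ties may be broken arbitrarily, so TopK_+ is a relation: [is_topKpos K x S]
   says that [S] is one of the admissible values of TopK_+(x).  The cardinality
   condition says that the budget is exhausted unless there are fewer than [K]
   strictly positive entries, in which case they are all selected. *)
Definition is_topKpos (R : realFieldType) (N K : nat) (x : 'I_N -> R)
    (S : {set 'I_N}) : Prop :=
  [/\ S \subset positive_entries x,
      #|S| = minn K #|positive_entries x|
    & forall i j : 'I_N, i \in S -> j \notin S -> x j <= x i].

Definition selection_loss (R : realFieldType) (N : nat) (V : 'I_N -> R)
    (Sstar Shat : {set 'I_N}) : R :=
  \sum_(n in Sstar) V n - \sum_(n in Shat) V n.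

(* Seeding the iterated maximum with an actual entry (hence the argument
   [0 < N]) makes it the maximum of the entries, whatever their signs. *)
Definition max_entry (R : realFieldType) (N : nat) (hN : (0 < N)%N)
    (f : 'I_N -> R) : R :=
  \big[Num.max/f (Ordinal hN)]_(n < N) f n.

Lemma is_topKpos_argmax (R : realFieldType) (N K : nat) (x : 'I_N -> R)
    (S : {set 'I_N}) :
  is_topKpos K x S <->
  [/\ (#|S| <= K)%N,
      forall T : {set 'I_N}, (#|T| <= K)%N ->
        \sum_(n in T) x n <= \sum_(n in S) x n
    & forall n, n \in S -> 0 < x n].
Proof.
split=> [[/subsetP SP cS topS]|[cS maxS posS]].
  have posS n : n \in S -> 0 < x n by move/SP; rewrite inE.
  split=> // [|T cT]; first by rewrite cS geq_minl.
  set T' := T :&: positive_entries x.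
  have leT : \sum_(n in T) x n <= \sum_(n in T') x n.
    rewrite (big_setID (positive_entries x)) /= -/T' gerDl.
    by apply: sumr_le0 => n; rewrite !inE -leNgt => /andP[].
  apply: le_trans leT _.
  have cT' : (#|T'| <= #|S|)%N.
    rewrite cS leq_min (subset_leq_card (subsetIr _ _)) andbT.
    exact: leq_trans (subset_leq_card (subsetIl _ _)) cT.
  have cD : (#|T' :\: S| <= #|S :\: T'|)%N.
    by rewrite -(leq_add2l #|T' :&: S|) cardsID setIC cardsID.
  rewrite (big_setID S) [leRHS](big_setID T') /= setIC lerD2l.
  have [S0|[i0 i0S]] := set_0Vmem (S :\: T').
    move: cD; rewrite S0 cards0 leqn0 cards_eq0 => /eqP ->.
    by rewrite !big_set0.
  case: (arg_minP x i0S) => m mS minm.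
  have mS' : m \in S by have : m \in S :\: T' := mS; rewrite inE => /andP[].
  apply: (@le_trans _ _ (x m *+ #|T' :\: S|)).
    rewrite -sumr_const; apply: ler_sum => j; rewrite inE => /andP[jS _].
    exact: topS.
  apply: (@le_trans _ _ (x m *+ #|S :\: T'|)).
    by rewrite ler_wpMn2l // ltW // posS.
  by rewrite -sumr_const; apply: ler_sum => j /minm.
have SP : S \subset positive_entries x.
  by apply/subsetP => n nS; rewrite inE posS.
split=> // [|i j iS jS].
  apply/eqP; rewrite eqn_leq leq_min cS subset_leq_card //= leqNgt.
  apply/negP; rewrite leq_min => /andP[ltK ltP].
  have /properP[_ [j jP jS]] : S \proper positive_entries x.
    by rewrite properEcard SP.
  have := maxS (j |: S); rewrite cardsU1 jS => /(_ ltK).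
  by rewrite big_setU1 //= gerDr leNgt; move: jP; rewrite inE => ->.
have jSi : j \notin S :\ i by rewrite inE (negbTE jS) andbF.
have := maxS (j |: (S :\ i)); rewrite cardsU1 jSi.
have -> : (true + #|S :\ i| = #|S|)%N by rewrite (cardsD1 i S) iS.
by move=> /(_ cS); rewrite big_setU1 //= (big_setD1 i iS) /= lerD2r.
Qed.

Lemma is_topKpos_exists (R : realFieldType) (N K : nat) (x : 'I_N -> R) :
  exists S : {set 'I_N}, is_topKpos K x S.
Proof.
have h0 : (#|(set0 : {set 'I_N})| <= K)%N by rewrite cards0.
case: (@arg_maxP _ R {set 'I_N} set0 (fun S => #|S| <= K)%N
         (fun S => \sum_(n in S) x n) h0) => S cS maxS.
exists (S :&: positive_entries x); apply/is_topKpos_argmax; split.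
- exact: leq_trans (subset_leq_card (subsetIl _ _)) cS.
- move=> T /maxS /le_trans; apply.
  rewrite (big_setID (positive_entries x)) /= gerDl.
  by apply: sumr_le0 => n; rewrite !inE -leNgt => /andP[].
- by move=> n; rewrite !inE => /andP[].
Qed.

(* Main.v *)
(* The true loss splits as
     [V(Sstar) - s(Sstar)] + [s(Sstar) - s(Shat)] + [s(Shat) - V(Shat)],
   whose middle term is nonpositive because Shat maximizes the score sum over
   the sets of size at most K, while the outer terms are at most the error sums
   over Sstar and Shat.  Nonnegativity is the optimality of Sstar for V. *)

Require Import Defs.
From HB Require Import structures.
From mathcomp Require Import all_boot all_order all_algebra.

Set Implicit Arguments.
Unset Strict Implicit.
Unset Printing Implicit Defensive.

Import Order.TTheory GRing.Theory Num.Theory.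
Local Open Scope ring_scope.

(** [Shat] respects the budget, so it is a competitor in the maximization that [Sstar] solves for
    [V]. *)
Lemma selection_loss_ge0 (R : realFieldType) (N K : nat) (V s : 'I_N -> R)
    (Sstar Shat : {set 'I_N}) :
  is_topKpos K V Sstar -> is_topKpos K s Shat ->
  0 <= selection_loss V Sstar Shat.
Proof.
move=> /is_topKpos_argmax[_ maxV _] /is_topKpos_argmax[cS _ _].
by rewrite subr_ge0 maxV.
Qed.

Lemma selection_loss_le (R : realFieldType) (N K : nat) (V s eps : 'I_N -> R)
    (Sstar Shat : {set 'I_N}) :
  is_topKpos K V Sstar -> is_topKpos K s Shat ->
  (forall n, `|s n - V n| <= eps n) ->
  selection_loss V Sstar Shat <= \sum_(n in Sstar) eps n + \sum_(n in Shat) eps n.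
Proof.
move=> /is_topKpos_argmax[cS _ _] /is_topKpos_argmax[_ maxs _] le_eps.
rewrite /selection_loss lerBlDr -addrA -big_split /=.
(* With the [V]-sum over [Shat] moved to the right, the chain passes from [V] to [s] on [Sstar],
   then to [s] on [Shat], then back to [V]; each change of values costs [eps]. *)
apply: (@le_trans _ _ (\sum_(n in Sstar) eps n + \sum_(n in Sstar) s n)).
  rewrite -big_split /=; apply: ler_sum => n _.
  by rewrite -lerBlDr; have := le_eps n; rewrite distrC => /ler_normlW.
rewrite lerD2l; apply: le_trans (maxs _ cS) _.
by apply: ler_sum => n _; rewrite -lerBlDr; apply: ler_normlW.
Qed.

Lemma sum_le_max_entry (R : realFieldType) (N K : nat) (hN : (0 < N)%N)
    (f : 'I_N -> R) (S : {set 'I_N}) :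
  (forall n, 0 <= f n) -> (#|S| <= K)%N ->
  \sum_(n in S) f n <= K%:R * max_entry hN f.
Proof.
move=> f_ge0 cS.
have le_max n : f n <= max_entry hN f by apply: le_bigmax.
apply: (@le_trans _ _ (max_entry hN f *+ #|S|)).
  by rewrite -sumr_const; apply: ler_sum.
(* Raising the count from [#|S|] to [K] needs a nonnegative maximum; it dominates the entry that
   seeds it. *)
rewrite mulr_natl ler_wpMn2l //.
exact: le_trans (f_ge0 (Ordinal hN)) (le_max _).
Qed.

Theorem proposition2 (R : realFieldType) (N K : nat) (hN : (0 < N)%N)
    (hK : (K <= N)%N) (t : nat)
    (omega : 'I_N -> R) (alpha sI se : R) (Ihat ehat : bool -> nat -> 'I_N -> R)
    (homega : forall n, 0 < omega n)
    (halpha : 0 <= alpha <= 1) (hsI : 0 < sI) (hse : 0 < se)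
    (hIhat : forall a n, 0 <= Ihat a t.+1 n)
    (hehat : forall a n, 0 <= ehat a t.+1 n)
    (V eps : nat -> 'I_N -> R) (Sstar Shat : {set 'I_N})
    (hSstar : is_topKpos K (V t) Sstar)
    (hShat : is_topKpos K (score omega alpha sI se Ihat ehat t) Shat)
    (heps : forall n, `|score omega alpha sI se Ihat ehat t n - V t n| <= eps t n) :
  [/\ 0 <= selection_loss (V t) Sstar Shat,
      selection_loss (V t) Sstar Shat
        <= \sum_(n in Sstar) eps t n + \sum_(n in Shat) eps t n
    & \sum_(n in Sstar) eps t n + \sum_(n in Shat) eps t n
        <= 2 * K%:R * max_entry hN (eps t)].
Proof.
(* The error bounds dominate absolute values; their sign matters when a set does not fill the
   budget. *)
have eps_ge0 n : 0 <= eps t n by apply: le_trans (normr_ge0 _) (heps n).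
have /is_topKpos_argmax[cSstar _ _] := hSstar.
have /is_topKpos_argmax[cShat _ _] := hShat.
split; first exact: selection_loss_ge0 hSstar hShat.
  exact: selection_loss_le hSstar hShat heps.
(* One copy of [K%:R * max_entry hN (eps t)] for each of the two sets. *)
rewrite -mulrA mulr_natl mulr2n.
by apply: lerD; apply: sum_le_max_entry.
Qed.
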